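(* Let $b_0\ge 2$ and assume that $S_{x^2,b_0}$ has $s$ distinct propagating cycles of lengths $\ell_1,\dots,\ell_s$ respectively (repetitions among the $\ell_i$ allowed). Let $\mathbf{t}\ge0$ be any integer and let $b=b_0+\mathbf{t}(b_0^2+1)$. Then $S_{x^2,b}$ has at least $s$ distinct propagating cycles, of lengths $\ell_1,\dots,\ell_s$ respectively.
   Context: For an integer $b\ge2$, define $S_{x^2,b}:\mathbb{Z}_{\ge0}\to\mathbb{Z}_{\ge0}$ by $S_{x^2,b}(n)=x_0^2+\dots+x_d^2$, where $n=x_0+x_1b+\dots+x_db^d$ is the base-$b$ expansion of $n$ ($0\le x_i<b$). A cycle of length $\ell$ of $S_{x^2,b}$ is a sequence of pairwise distinct positive integers $\mathrm{cyc}(n_1,\dots,n_\ell)$ with $S_{x^2,b}(n_i)=n_{i+1}$ for $1\le i<\ell$ and $S_{x^2,b}(n_\ell)=n_1$, considered up to cyclic permutation (distinct cycles means distinct up to cyclic permutation). Such a cycle is propagating if every $n_i$ has at most two base-$b$ digits and $b$ divides no $n_i$. *)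

(* Defs.v *)
From mathcomp Require Import all_boot.

Set Implicit Arguments.
Unset Strict Implicit.
Unset Printing Implicit Defensive.

Definition digit (b n i : nat) : nat := (n %/ b ^ i) %% b.

(* trunc_log b n is the index d of the leading digit of n > 0; since
   trunc_log b 0 = 0, the number 0 is written with the single digit 0. *)
Definition ndigits (b n : nat) : nat := (trunc_log b n).+1.

Lemma digit_lt (b n i : nat) : 1 < b -> digit b n i < b.
Proof. by move=> b_gt1; rewrite ltn_mod (ltn_trans _ b_gt1). Qed.

Lemma base_expansion (b n : nat) : 1 < b ->
  n = \sum_(i < ndigits b n) digit b n i * b ^ i.
Proof.
move=> b_gt1.
have modE m : n %% b ^ m = \sum_(i < m) digit b n i * b ^ i.
  elim: m => [|m IHm]; first by rewrite big_ord0 expn0 modn1.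
  rewrite big_ord_recr /= -IHm /digit.
  have b_gt0 : 0 < b := ltnW b_gt1.
  rewrite [in LHS](divn_eq n (b ^ m)) [in LHS](divn_eq (n %/ b ^ m) b).
  rewrite mulnDl -mulnA -expnS -addnA modnMDl addnC modn_small //.
  have lt1 : n %% b ^ m < b ^ m by rewrite ltn_mod expn_gt0 b_gt0.
  have lt2 : (n %/ b ^ m) %% b < b by rewrite ltn_mod.
  by rewrite expnS (leq_trans (n := b ^ m + (n %/ b ^ m) %% b * b ^ m)) //
    ?ltn_add2r // -mulSn leq_mul2r lt2 orbT.
rewrite -modE modn_small //.
by rewrite /ndigits trunc_log_ltn.
Qed.

Lemma leading_digit_neq0 (b n : nat) : 1 < b -> 0 < n ->
  digit b n (ndigits b n).-1 != 0.
Proof.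
move=> b_gt1 n_gt0; rewrite /digit /ndigits /=.
have b_gt0 : 0 < b := ltnW b_gt1.
have /andP[le_n n_lt] := trunc_log_bounds b_gt1 n_gt0.
rewrite modn_small ?ltn_divLR ?expn_gt0 ?b_gt0 -?expnS //.
by rewrite -lt0n divn_gt0 // expn_gt0 b_gt0.
Qed.

Definition digit_square_sum (b n : nat) : nat :=
  \sum_(i < ndigits b n) digit b n i ^ 2.

Definition is_cycle (b : nat) (c : seq nat) : Prop :=
  [/\ c <> [::], uniq c, {in c, forall n, 0 < n}
    & fcycle (digit_square_sum b) c].

Definition propagating_cycle (b : nat) (c : seq nat) : Prop :=
  is_cycle b c /\ {in c, forall n, ndigits b n <= 2 /\ ~ (b %| n)}.

Definition same_cycle (c1 c2 : seq nat) : Prop := exists k, c2 = rot k c1.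

Definition has_propagating_cycles (b s : nat) (l : 'I_s -> nat) : Prop :=
  exists c : 'I_s -> seq nat,
    (forall i, propagating_cycle b (c i) /\ size (c i) = l i) /\
    (forall i j, i <> j -> ~ same_cycle (c i) (c j)).

(* Main.v *)
Require Import Defs.
From mathcomp Require Import all_boot zify.

Set Implicit Arguments.
Unset Strict Implicit.
Unset Printing Implicit Defensive.

(** Put [K = (1 + t b0)^2 + t^2], so that [b^2 + 1 = (b0^2 + 1) K].  If
    [n = x + y b0] is a two-digit number with [x <> 0], then [K n] has in base
    [b] the digits [X = (1 + t b0) x - t y] and [Y = (1 + t b0) y + t x], i.e.
    [X + iY = (x + iy)(1 + t b0 + it)].  Taking norms in the Gaussian integers,
    [X^2 + Y^2 = K (x^2 + y^2)], so multiplication by [K] intertwines the two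
    digit maps on propagating cycles. *)

Lemma ndigits_le2 (b n : nat) : 1 < b -> (ndigits b n <= 2) = (n < b ^ 2).
Proof.
move=> b_gt1; case: n => [|n]; first by rewrite /ndigits trunc_log0 expn_gt0 (ltnW b_gt1).
apply/idP/idP => [le_nd|lt_n].
  apply: leq_trans (trunc_log_ltn n.+1 b_gt1) _.
  by rewrite leq_exp2l.
have [//|le2] := leqP (ndigits b n.+1) 2.
have := trunc_logP b_gt1 (ltn0Sn n).
by rewrite leqNgt (leq_trans lt_n) // leq_exp2l.
Qed.

Lemma digit_square_sum_two_digits (b x y : nat) : 1 < b -> x < b -> y < b ->
  digit_square_sum b (x + y * b) = x ^ 2 + y ^ 2.
Proof.
move=> b_gt1 lt_x lt_y; have b_gt0 := ltnW b_gt1.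
have le2 : ndigits b (x + y * b) <= 2 by rewrite ndigits_le2 //; nia.
have d0 : digit b (x + y * b) 0 = x.
  by rewrite /digit expn0 divn1 addnC modnMDl modn_small.
have d1 : digit b (x + y * b) 1 = y.
  by rewrite /digit expn1 addnC divnMDl // (divn_small lt_x) addn0 modn_small.
have dE i : 1 < i -> digit b (x + y * b) i = 0.
  move=> lt1i; rewrite /digit divn_small ?mod0n //.
  apply: (@leq_trans (b ^ 2)); first by rewrite -ndigits_le2.
  by rewrite leq_exp2l.
transitivity (\sum_(i < 2) digit b (x + y * b) i ^ 2); last first.
  by rewrite big_ord_recr big_ord1 /= d0 d1.
(* [y] may be 0; then the number has a single digit and the sum a single term, and the missing
   second digit would contribute 0. *)
move: le2; rewrite /digit_square_sum /ndigits.
case E: (trunc_log b (x + y * b)) => [|[|//]] // _.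
have y0 : y = 0.
  have := trunc_log_ltn (x + y * b) b_gt1; rewrite E expn1.
  by case: (y) => // y'; nia.
by rewrite big_ord1 big_ord_recr big_ord1 /= d1 y0 exp0n // addn0.
Qed.

Definition lift_base (b0 t : nat) : nat := b0 + t * (b0 ^ 2 + 1).

Definition lift_factor (b0 t : nat) : nat := (1 + t * b0) ^ 2 + t ^ 2.

Lemma lift_factor_gt0 (b0 t : nat) : 0 < lift_factor b0 t.
Proof. by rewrite /lift_factor addn_gt0 expn_gt0. Qed.

Section Lift.

Variables b0 t : nat.
Hypothesis b0_gt1 : 1 < b0.

Let b := lift_base b0 t.
Let K := lift_factor b0 t.

Lemma lift_base_gt1 : 1 < b.
Proof. by rewrite /b /lift_base (leq_trans b0_gt1) ?leq_addr. Qed.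

(** With [w = 1 + t b0 + i t] one has [1 - i b = (1 - i b0) conj(w)], so [X + Y b = Re((x + i y) w
    (1 - i b)) = K Re((x + i y)(1 - i b0)) = K (x + y b0)]. *)
Lemma lift_digits (x y : nat) : 0 < x -> x < b0 -> y < b0 ->
  exists X Y, [/\ K * (x + y * b0) = X + Y * b, 0 < X < b, Y < b
                & X ^ 2 + Y ^ 2 = K * (x ^ 2 + y ^ 2)].
Proof.
move=> x_gt0 lt_x lt_y.
(* Since [y < b0 <= b0 x], the subtraction defining [X] is not truncated, and [X >= x > 0]. *)
have le_ty : t * y <= t * b0 * x by rewrite -mulnA leq_mul2l; apply/orP; right; nia.
exists ((1 + t * b0) * x - t * y), ((1 + t * b0) * y + t * x).
have [X XE] : exists X, (1 + t * b0) * x = X + t * y.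
  by exists ((1 + t * b0) * x - t * y); nia.
rewrite XE addnK /K /b /lift_factor /lift_base; split.
- nia.
(* The upper bounds come from [x, y <= b0 - 1]: [X <= (1 + t b0)(b0 - 1)] and [Y <= (1 + t b0 +
   t)(b0 - 1) = b0 - 1 + t (b0^2 - 1)], both below [b]. *)
- apply/andP; split; nia.
- nia.
- nia.
Qed.

Lemma propagating_digits (n : nat) : ndigits b0 n <= 2 -> ~ (b0 %| n) ->
  exists x y, [/\ n = x + y * b0, 0 < x, x < b0 & y < b0].
Proof.
rewrite ndigits_le2 // => lt_n /negP ndvd.
exists (n %% b0), (n %/ b0); split.
- by rewrite addnC -divn_eq.
- by rewrite lt0n.
- by rewrite ltn_mod ltnW.
- by rewrite ltn_divLR ?(ltnW b0_gt1) // mulnn.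
Qed.

Lemma digit_square_sum_lift (n : nat) : ndigits b0 n <= 2 -> ~ (b0 %| n) ->
  digit_square_sum b (K * n) = K * digit_square_sum b0 n.
Proof.
move=> le2 ndvd; have [x [y [-> x_gt0 lt_x lt_y]]] := propagating_digits le2 ndvd.
have [X [Y [-> /andP[_ lt_X] lt_Y E]]] := lift_digits x_gt0 lt_x lt_y.
by rewrite !digit_square_sum_two_digits ?lift_base_gt1.
Qed.

Lemma propagating_lift (n : nat) : ndigits b0 n <= 2 -> ~ (b0 %| n) ->
  ndigits b (K * n) <= 2 /\ ~ (b %| K * n).
Proof.
move=> le2 ndvd; have [x [y [-> x_gt0 lt_x lt_y]]] := propagating_digits le2 ndvd.
have [X [Y [-> /andP[X_gt0 lt_X] lt_Y _]]] := lift_digits x_gt0 lt_x lt_y.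
split; first by rewrite ndigits_le2 ?lift_base_gt1 //; nia.
(* If [b] divided [X + Y b] it would divide [X], which lies strictly between 0 and [b]. *)
by rewrite dvdn_addl ?dvdn_mull // => /(dvdn_leq X_gt0); rewrite leqNgt lt_X.
Qed.

Lemma muln_lift_factor_inj : injective (muln K).
Proof. by move=> m n /eqP; rewrite eqn_pmul2l ?lift_factor_gt0 // => /eqP. Qed.

Lemma propagating_cycle_lift (c : seq nat) :
  propagating_cycle b0 c -> propagating_cycle b (map (muln K) c).
Proof.
move=> [[c_neq0 c_uniq c_gt0 c_cyc] c_prop]; split; last first.
  by move=> _ /mapP[n /c_prop[le2 ndvd] ->]; exact: propagating_lift.
split.
- by case: c c_neq0 {c_uniq c_gt0 c_cyc c_prop}.
- by rewrite (map_inj_uniq muln_lift_factor_inj).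
- by move=> _ /mapP[n /c_gt0 n_gt0 ->]; rewrite muln_gt0 lift_factor_gt0.
(* The intertwining holds only for propagating numbers, so it is used relative to the members of
   [c]. *)
- apply: (homo_cycle_in (P := mem c)) (c_cyc); last exact/allP.
  move=> m n /c_prop[le2 ndvd] _ /eqP <-; apply/eqP.
  exact: digit_square_sum_lift.
Qed.

(** Rotation commutes with [map], and multiplication by [K] is injective; hence distinct cycles keep
    distinct lifts. *)
Lemma same_cycle_lift (c1 c2 : seq nat) :
  same_cycle (map (muln K) c1) (map (muln K) c2) -> same_cycle c1 c2.
Proof.
move=> [k]; rewrite -map_rot => /(inj_map muln_lift_factor_inj) ->.
by exists k.
Qed.

End Lift.

Theorem theorem2p7 (b0 s : nat) (l : 'I_s -> nat) (t : nat) :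
  2 <= b0 ->
  has_propagating_cycles b0 l ->
  has_propagating_cycles (b0 + t * (b0 ^ 2 + 1)) l.
Proof.
move=> b0_gt1 [c [c_prop c_diff]].
exists (fun i => map (muln (lift_factor b0 t)) (c i)); split=> [i|i j neq_ij].
  have [ci_prop <-] := c_prop i; rewrite size_map; split=> //.
  exact: propagating_cycle_lift.
by move=> /same_cycle_lift; exact: c_diff.
Qed.
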